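(* Let $\mathbf A=(A,\leq,{}')$ be a Kleene poset. Then $\big(G(\mathbf A),\subseteq,{}^{\bot}\big)$ is a Kleene lattice, and $X=\{L(a)\mid a\in A\}$ is involution-closed and doubly dense in $G(\mathbf A)$, generates $G(\mathbf A)$, and $(X,\subseteq,{}^{\bot})$ is isomorphic to $\mathbf A$.
   Context: Let $(A,\leq)$ be a poset. For $B,C\subseteq A$, $B\leq C$ means $x\leq y$ for all $x\in B$, $y\in C$. $L(B)=\{x\in A\mid x\leq B\}$, $U(B)=\{x\in A\mid B\leq x\}$; several arguments denote the union, e.g. $L(b,c)=L(\{b,c\})$, $L(B_1,\dots,B_n)=L(B_1\cup\dots\cup B_n)$; $LU(B)=L(U(B))$. The poset is distributive if $L\big(U(x,y),z\big)=LU\big(L(x,z),L(y,z)\big)$ for all $x,y,z$. An antitone involution is a unary operation ${}'$ with $x\leq y\Rightarrow y'\leq x'$ and $x''=x$. A Kleene poset is a distributive poset with an antitone involution ${}'$ such that $L(x,x')\leq U(y,y')$ for all $x,y$. A Kleene lattice is a distributive lattice with an antitone involution satisfying $x\wedge x'\leq y\vee y'$ for all $x,y$. For a distributive poset $\mathbf A$, $G(\mathbf A)=\{L\big(U(A_1),\dots,U(A_n)\big)\mid n\geq 1,\ A_1,\dots,A_n \text{ finite non-empty subsets of } A\}$, ordered by inclusion. For $C\subseteq A$, $C'=\{x'\mid x\in C\}$ and $C^{\bot}=L(C')=\{a\in A\mid a\leq x'\text{ for all }x\in C\}$. A subset $X$ of a poset $\mathbf Q$ is doubly dense in $\mathbf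 Q$ if $q=\bigvee_{\mathbf Q}\big(L(q)\cap X\big)=\bigwedge_{\mathbf Q}\big(U(q)\cap X\big)$ for every $q\in\mathbf Q$ ($L,U$ computed in $\mathbf Q$). If $\mathbf Q$ has an antitone involution, $X$ is involution-closed and doubly dense if it is doubly dense and closed under the involution. ''Generates'' means generates as a lattice. *)

(* Defs.v *)
From HB Require Import structures.
From mathcomp Require Import all_boot all_order.
From mathcomp Require Import boolp classical_sets functions cardinality.

Set Implicit Arguments.
Unset Strict Implicit.
Unset Printing Implicit Defensive.

Import Order.Theory.
Local Open Scope classical_set_scope.
Local Open Scope order_scope.

(* L(B) and U(B) are [lbound B] and [ubound B]; joins and meets
   that need not exist are expressed by membership in [supremums] and
   [infimums]. *)

Section Posets.
Context {d : Order.disp_t} {T : porderType d}.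
Implicit Types (x y z : T) (B C X : set T) (f : T -> T).

Definition set_le B C : Prop := forall x y, B x -> C y -> x <= y.

Definition antitone_involution f : Prop :=
  (forall x y, x <= y -> f y <= f x) /\ involutive f.

Definition doubly_dense X : Prop := forall q,
  supremums (lbound [set q] `&` X) q /\ infimums (ubound [set q] `&` X) q.

Definition involution_closed f X : Prop := forall x, X x -> X (f x).

Definition sublattice X : Prop := forall x y z, X x -> X y ->
  (infimums [set x; y] z -> X z) /\ (supremums [set x; y] z -> X z).

Definition generates X : Prop :=
  forall S : set T, X `<=` S -> sublattice S -> S = [set: T].

End Posets.

Definition distributive_poset d (T : porderType d) : Prop :=
  forall x y z : T,
    lbound (ubound [set x; y] `|` [set z]) =
    lbound (ubound (lbound [set x; z] `|` lbound [set y; z])).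

Definition kleene_poset d (T : porderType d) (f : T -> T) : Prop :=
  [/\ distributive_poset T,
      antitone_involution f &
      forall x y, set_le (lbound [set x; f x]) (ubound [set y; f y])].

Definition lattice_operations d (T : porderType d) (meet join : T -> T -> T) :
    Prop :=
  forall x y, infimums [set x; y] (meet x y) /\ supremums [set x; y] (join x y).

Definition kleene_lattice d (T : porderType d) (f : T -> T) : Prop :=
  exists meet join : T -> T -> T,
    [/\ lattice_operations meet join,
        left_distributive meet join,
        antitone_involution f &
        forall x y, meet x (f x) <= join y (f y)].

(* [X], with the order and the operation [g] of [S], is isomorphic to
   [(T, <=, f)]; [X] is meant to be closed under [g]. *)
Definition isomorphic_onto d (T : porderType d) (f : T -> T)
    d' (S : porderType d') (g : S -> S) (X : set S) : Prop :=
  exists phi : T -> S,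
    [/\ set_bij [set: T] X phi,
        {mono phi : x y / x <= y} &
        {morph phi : x / f x >-> g x}].

Section GA.
Context {d : Order.disp_t} (A : porderType d).

Definition G_sets : set (set A) :=
  [set C | exists (n : nat) (F : 'I_n -> set A),
    [/\ (0 < n)%N,
        forall i, finite_set (F i) /\ F i !=set0 &
        C = lbound (\bigcup_i ubound (F i))]].

Record GA : Type := InGA { GA_set : set A; _ : GA_set \in G_sets }.

HB.instance Definition _ := [isSub for GA_set].
HB.instance Definition _ := [Choice of GA by <:].
(* The order inherited from [set A] is inclusion. *)
HB.instance Definition _ := [SubChoice_isSubPOrder of GA by <: with set_display].

Definition perp (f : A -> A) (C : set A) : set A := lbound (f @` C).

Definition principal_sets : set (set A) := range (fun a => lbound [set a]).

Definition principals : set GA := [set q | principal_sets (GA_set q)].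

End GA.

Arguments G_sets {d} A.
Arguments principal_sets {d} A.
Arguments principals {d} A.

(* Main.v *)
Require Import Defs.
From mathcomp Require Import all_boot all_order.
From mathcomp Require Import boolp classical_sets functions cardinality.

(** Everything rests on a cut rule.  If [w <= u] fails in a distributive poset,
    then for every [x] one can lower [w] below [x], or raise [u] above [x],
    so that [w <= u] still fails ([nle_cut]): otherwise every element below
    both [w] and [x] is below [u], and every element above both [u] and [x] is
    above [w], and distributivity puts [w] in [LU(L(u, w), L(x, w))], hence
    below [u].

    Iterating, finitely many elements can be decided at once, as by a prime
    filter: each is above the new [w] or below the new [u].  Applied to the
    elements of the finite sets [F_i] defining a member [C] of [G(A)], that is,
    the intersection of the sets [LU(F_i)], this leaves two cases: some choice
    of one element in each [F_i] lies entirely above [w], or some [F_i] lies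
    entirely below [u] ([nle_cut_transversal]).  So the cut rule extends from
    elements of [A] to members of [G(A)]: [w] can be lowered into [C], or [u]
    raised above all of [C] ([nle_cut_G]).

    The first form, with choices, shows that the upper bounds of [C] are the
    [u] that are, for each choice [c], upper bounds of [L(c)]; so the perp of
    [C] is again a finite intersection of sets [LU(c')], and [G(A)] is closed
    under perp ([G_sets_perp]).  Intersections are the meets, and perp is an
    antitone involution because members of [G(A)] are LU-closed, so joins exist
    by De Morgan.  The second form gives distributivity: if [w] is in the
    meet of [C \/ D] with [E] but not in the join of the two meets, some upper
    bound [u] of that join is not above [w]; cutting at [C] and at [D] either
    sends [w] into one of the two meets, or puts [C \/ D] below [u], and both
    are absurd.  The Kleene inequality, the density of principal ideals and the
    isomorphism then hold in any such completion, and the principal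
    ideals generate because a member of [G(A)] is a finite meet of sets
    [LU(F)], each of which is a finite join of principal ideals. *)

Set Implicit Arguments.
Unset Strict Implicit.
Unset Printing Implicit Defensive.

Import Order.Theory.
Local Open Scope classical_set_scope.
Local Open Scope order_scope.

(** * Choosing one entry in each of finitely many lists *)

Section Transversals.
Context {T : eqType}.
Implicit Types (s c : seq T) (ss : seq (seq T)).

Fixpoint transversals ss : seq (seq T) :=
  if ss is s :: ss' then [seq x :: c | x <- s, c <- transversals ss']
  else [:: [::]].

Lemma transversals_meet ss c s :
  c \in transversals ss -> s \in ss -> exists2 x, x \in c & x \in s.
Proof.
elim: ss c => [//|t ss IH] c /= /allpairsP[[x c'] /= [xt c'ss ->]].
rewrite inE => /predU1P[->|sss]; first by exists x; rewrite ?mem_head.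
by have [y yc ys] := IH _ c'ss sss; exists y; rewrite // inE yc orbT.
Qed.

Lemma transversals_exists ss (P : T -> Prop) :
  (forall s, s \in ss -> exists2 x, x \in s & P x) ->
  exists2 c, c \in transversals ss & forall x, x \in c -> P x.
Proof.
elim: ss => [|s ss IH] H; first by exists [::].
have [x xs Px] := H s (mem_head _ _).
have [|c css Pc] := IH; first by move=> t tss; apply: H; rewrite inE tss orbT.
exists (x :: c); first by apply/allpairsP; exists (x, c).
by move=> y; rewrite inE => /predU1P[->//|/Pc].
Qed.

Lemma transversals_nnil ss : ss != [::] -> [::] \notin transversals ss.
Proof.
by case: ss => // s ss _; apply/negP => /= /allpairsP[[x c] /= []].
Qed.

Lemma transversals_neq0 ss : [::] \notin ss -> transversals ss != [::].
Proof.
move=> ss0; have [s sss|c css _] := @transversals_exists ss (fun=> True).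
  by case: s sss => [/(negP ss0)//|x s _]; exists x; rewrite ?mem_head.
by case: (transversals ss) css.
Qed.

End Transversals.

(** * Normal forms for the members of G(A) *)

Section NormalForms.
Context {d : Order.disp_t} {A : porderType d}.
Implicit Types (a u w x : A) (s : seq A) (ss : seq (seq A)) (B C D : set A).

Definition join_cut s : set A := lbound (ubound [set` s]).

Definition meet_of_joins ss : set A :=
  [set a | forall s, s \in ss -> join_cut s a].

Lemma G_setsP C : G_sets A C <->
  exists ss, [/\ ss != [::], [::] \notin ss & C = meet_of_joins ss].
Proof.
split=> [[n [F [n0 Fi ->]]]|[ss [ss0 nss ->]]].
  have /choice[s sF] : forall i, exists s : seq A, F i = [set` s].
    by move=> i; have [/finite_seqP] := Fi i.
  exists [seq s i | i <- enum 'I_n]; split.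
  - by rewrite -size_eq0 size_map size_enum_ord -lt0n.
  - apply/negP => /mapP[i _ si]; have [_ [x]] := Fi i.
    by rewrite sF -si.
  - apply/seteqP; split=> a aF.
      move=> _ /mapP[i _ ->] u us; apply: aF.
      by exists i => //; rewrite sF.
    move=> u [i _]; rewrite sF => us; apply: (aF (s i)) => //.
    by apply: map_f; rewrite mem_enum.
exists (size ss), (fun i => [set` nth [::] ss i]); split.
- by rewrite lt0n size_eq0.
- move=> i; split; first exact: finite_seq.
  case E : (nth [::] ss i) => [|x s]; last by exists x; rewrite /= mem_head.
  by move/negP: nss; rewrite -E mem_nth.
- apply/seteqP; split=> a aF.
    by move=> u [i _ /= us]; apply: (aF (nth [::] ss i)); rewrite ?mem_nth.
  move=> s sss u us; have i_lt : (index s ss < size ss)%N by rewrite index_mem.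
  by apply: aF; exists (Ordinal i_lt); rewrite //= nth_index.
Qed.

Lemma join_cut1 a : join_cut [:: a] = lbound [set a].
Proof.
apply/seteqP; split=> x.
  by move=> xa _ ->; apply: xa => y /=; rewrite inE => /eqP->.
move=> xa u ua; apply: le_trans (xa _ erefl) _.
by apply: ua; rewrite /= mem_head.
Qed.

Lemma join_cut_mem s x : x \in s -> join_cut s x.
Proof. by move=> xs u; apply. Qed.

Lemma join_cut_down s x y : x <= y -> join_cut s y -> join_cut s x.
Proof. by move=> xy ys u us; apply: le_trans xy (ys u us). Qed.

Lemma G_sets_join_cut s : s != [::] -> G_sets A (join_cut s).
Proof.
move=> s0; apply/G_setsP; exists [:: s]; split=> //.
  by rewrite inE eq_sym.
apply/seteqP; split=> x; first by move=> xs t; rewrite inE => /eqP->.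
by apply; rewrite mem_head.
Qed.

Lemma G_sets_principal a : G_sets A (lbound [set a]).
Proof. by rewrite -join_cut1; apply: G_sets_join_cut. Qed.

Lemma G_setsI C D : G_sets A C -> G_sets A D -> G_sets A (C `&` D).
Proof.
move=> /G_setsP[ss [ss0 nss ->]] /G_setsP[tt [_ ntt ->]].
apply/G_setsP; exists (ss ++ tt); split.
- by case: ss ss0 {nss}.
- by rewrite mem_cat negb_or nss.
- apply/seteqP; split=> [x [xs xt] s|x xst].
    by rewrite mem_cat => /orP[/xs|/xt].
  by split=> s sin; apply: xst; rewrite mem_cat sin ?orbT.
Qed.

Lemma G_sets_down C x y : G_sets A C -> x <= y -> C y -> C x.
Proof.
by move=> /G_setsP[ss [_ _ ->]] xy Cy s /Cy; apply: join_cut_down.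
Qed.

Lemma G_sets_LU C : G_sets A C -> lbound (ubound C) = C.
Proof.
move=> [n [F [_ _ ->]]]; apply/seteqP; split=> x; last by move=> Cx u; apply.
by move=> H u uF; apply: H => y; apply.
Qed.

(** A non-member of [C] is detected by an element of [A]: this is where failures
    of inclusion become failures of [w <= u], to which cuts apply. *)
Lemma G_sets_separate C w :
  G_sets A C -> ~ C w -> exists2 u, ubound C u & ~ w <= u.
Proof.
move=> GC nCw; apply: contrapT => H; apply: nCw.
rewrite -(G_sets_LU GC) => u Cu; apply: contrapT => wu.
by apply: H; exists u.
Qed.

(** * The cut rule *)

Section Cut.
Hypothesis distrA : distributive_poset A.

Lemma nle_cut w u x : ~ w <= u ->
  (exists v, [/\ v <= w, v <= x & ~ v <= u]) \/
  (exists v, [/\ u <= v, x <= v & ~ w <= v]).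
Proof.
move=> nwu; apply: contrapT => /not_orP[lowN upN]; apply: nwu.
have xwu v : v <= x -> v <= w -> v <= u.
  by move=> vx vw; apply: contrapT => vu; apply: lowN; exists v.
have uxw v : u <= v -> x <= v -> w <= v.
  by move=> uv xv; apply: contrapT => wv; apply: upN; exists v.
have : lbound (ubound [set u; x] `|` [set w]) w.
  move=> v [vux|->//]; apply: uxw; apply: vux; first by left.
  by right.
rewrite distrA; apply=> v [] vl; first by apply: vl; left.
by apply: xwu; apply: vl; [left|right].
Qed.

(** Finitely many elements are decided together, because the alternatives
    already obtained survive further lowering of [w] and raising of [u]. *)
Lemma nle_cut_seq s w u : ~ w <= u ->
  exists w' u', [/\ w' <= w, u <= u', ~ w' <= u' &
    forall x, x \in s -> w' <= x \/ x <= u'].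
Proof.
elim: s w u => [|x s IH] w u nwu; first by exists w, u; split.
have [w1 [u1 [w1w uu1 nwu1 dec]]] := IH _ _ nwu.
have [[v [vw vx nv]]|[v [uv xv nv]]] := nle_cut x nwu1.
  exists v, u1; split=> //; first exact: le_trans w1w.
  move=> y; rewrite inE => /predU1P[->|/dec[wy|]]; [by left| |by right].
  by left; apply: le_trans wy.
exists w1, v; split=> //; first exact: le_trans uv.
move=> y; rewrite inE => /predU1P[->|/dec[|yu]]; [by right|by left|].
by right; apply: le_trans uv.
Qed.

Lemma nle_cut_transversal ss w u : ~ w <= u ->
  exists w' u', [/\ w' <= w, u <= u', ~ w' <= u' &
    (exists2 c, c \in transversals ss & lbound [set` c] w') \/
    (exists2 s, s \in ss & ubound [set` s] u')].
Proof.
move=> nwu; have [w' [u' [w'w uu' nwu' dec]]] := nle_cut_seq (flatten ss) nwu.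
exists w', u'; split=> //.
have [below|notbelow] := pselect (exists2 s, s \in ss & ubound [set` s] u').
  by right.
left; apply: transversals_exists => s sss.
apply: contrapT => H; apply: notbelow; exists s => // x /= xs.
have [wx|//] : w' <= x \/ x <= u' by apply: dec; apply/flattenP; exists s.
by case: H; exists x.
Qed.

Lemma lbound_transversal ss c :
  c \in transversals ss -> lbound [set` c] `<=` meet_of_joins ss.
Proof.
move=> css w wc s sss; have [x xc xs] := transversals_meet css sss.
exact: join_cut_down (wc x xc) (join_cut_mem xs).
Qed.

Lemma nle_cut_G C w u : G_sets A C -> ~ w <= u ->
  exists w' u', [/\ w' <= w, u <= u', ~ w' <= u' & C w' \/ ubound C u'].
Proof.
move=> /G_setsP[ss [_ _ ->]] nwu.
have [w' [u' [w'w uu' nwu' dec]]] := nle_cut_transversal ss nwu.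
exists w', u'; split=> //; case: dec => [[c css wc]|[s sss us]].
  by left; apply: lbound_transversal css _ wc.
by right=> y /(_ s sss); apply.
Qed.

(** This is the rewriting of a conjunctive normal form into a disjunctive one:
    in the completion, the meet of joins equals the join of the finite meets
    [L(c)] over all transversals [c].  It is phrased with upper bounds because
    perp only looks at them. *)
Lemma ubound_meet_of_joins ss u :
  ubound (meet_of_joins ss) u <->
  forall c, c \in transversals ss -> ubound (lbound [set` c]) u.
Proof.
split=> [uss c css w wc|uc w wss].
  by apply: uss; apply: lbound_transversal css _ wc.
apply: contrapT => nwu.
have [w' [u' [w'w uu' nwu' dec]]] := nle_cut_transversal ss nwu.
apply: nwu'; case: dec => [[c css wc]|[s sss us]].
  by apply: le_trans uu'; apply: uc css _ wc.
by apply: le_trans w'w _; apply: wss sss _ us.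
Qed.

End Cut.

(** * The perp operation *)

Section Involution.
Variable prime : A -> A.
Hypothesis primeA : antitone_involution prime.

Let primeK : involutive prime. Proof. by case: primeA. Qed.

Lemma prime_le_swap x y : (x <= prime y) = (y <= prime x).
Proof.
case: primeA => anti invo.
by apply/idP/idP => /anti; rewrite invo.
Qed.

Lemma perpE C a : perp prime C a <-> ubound C (prime a).
Proof.
split=> [H x Cx|H _ [x Cx <-]]; rewrite prime_le_swap; last exact: H.
by apply: H; exists x.
Qed.

Lemma perpK C : G_sets A C -> perp prime (perp prime C) = C.
Proof.
move=> GC; rewrite -[RHS](G_sets_LU GC); apply/seteqP; split=> a.
  move=> /perpE H u Cu; rewrite -(primeK u) prime_le_swap; apply: H.
  by apply/perpE; rewrite primeK.
by move=> H; apply/perpE => x /perpE Cx; rewrite prime_le_swap; apply: H.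
Qed.

Lemma perpS C D : C `<=` D -> perp prime D `<=` perp prime C.
Proof. by move=> CD a /perpE H; apply/perpE => x /CD; apply: H. Qed.

Lemma perp_principal a : perp prime (lbound [set a]) = lbound [set prime a].
Proof.
apply/seteqP; split=> b.
  by move=> /perpE H _ ->; rewrite prime_le_swap; apply: H => _ ->.
move=> H; apply/perpE => x xa; apply: le_trans (xa _ erefl) _.
by rewrite prime_le_swap; apply: H.
Qed.

Lemma G_sets_perp C :
  distributive_poset A -> G_sets A C -> G_sets A (perp prime C).
Proof.
move=> distrA /G_setsP[ss [ss0 nss ->]]; apply/G_setsP.
exists [seq map prime c | c <- transversals ss]; split.
- by rewrite -size_eq0 size_map size_eq0 transversals_neq0.
- apply/negP => /mapP[c css /esym/eqP].
  rewrite -size_eq0 size_map size_eq0 => /eqP c0.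
  by move: css; rewrite c0 => /(negP (transversals_nnil ss0)).
apply/seteqP; split=> a.
  move=> /perpE/(ubound_meet_of_joins distrA) H _ /mapP[c css ->] u uc.
  rewrite -(primeK u) prime_le_swap; apply: H css _ _ => x xc.
  by rewrite -(primeK x) prime_le_swap primeK; apply: uc; apply: map_f.
move=> H; apply/perpE/(ubound_meet_of_joins distrA) => c css w wc.
rewrite prime_le_swap; apply: (H (map prime c)); first exact: map_f.
move=> _ /mapP[x xc ->]; rewrite prime_le_swap primeK; exact: wc.
Qed.

End Involution.
End NormalForms.

(** * The lattice G(A) *)

Section Lattice.
Context {d : Order.disp_t} {A : porderType d}.
Implicit Types (P Q R : GA A) (X : set (GA A)).

Definition mkG (C : set A) (GC : G_sets A C) : GA A := InGA (mem_set GC).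

Lemma GA_setP P : G_sets A (GA_set P).
Proof. by case: P => C /= /set_mem. Qed.

Lemma le_GA P Q : (P <= Q) <-> (GA_set P `<=` GA_set Q).
Proof. by rewrite -subsetEset. Qed.

Definition principal a : GA A := mkG (G_sets_principal a).

Lemma principal_in a : principals A (principal a).
Proof. by exists a. Qed.

Lemma le_principal a P : (principal a <= P) <-> GA_set P a.
Proof.
rewrite le_GA; split=> [|Pa b /(_ a erefl) ba]; first by apply=> _ ->.
exact: G_sets_down (GA_setP P) ba Pa.
Qed.

Lemma le_principalr P u : (P <= principal u) <-> ubound (GA_set P) u.
Proof.
rewrite le_GA; split=> [H x /H|H x /H xu _ ->//]; exact.
Qed.

(** A supremum of principal ideals only tests membership of elements in [P]; an
    infimum only tests its upper bounds, and [P] is LU-closed. *)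
Lemma principals_doubly_dense : doubly_dense (principals A).
Proof.
move=> P; split; split.
- by move=> Q [QP _]; apply: QP.
- move=> R HR; apply/le_GA => a Pa; apply/le_principal; apply: HR; split.
    by move=> _ ->; apply/le_principal.
  exact: principal_in.
- by move=> Q [QP _]; apply: QP.
- move=> R HR; apply/le_GA => a Ra; rewrite -(G_sets_LU (GA_setP P)) => u Pu.
  have : R <= principal u.
    apply: HR; split; last exact: principal_in.
    by move=> _ ->; apply/le_principalr.
  by move/le_principalr; apply.
Qed.

Definition meetG P Q : GA A := mkG (G_setsI (GA_setP P) (GA_setP Q)).

Lemma meetG_inf P Q : infimums [set P; Q] (meetG P Q).
Proof.
split=> [R [->|->]|R HR]; [by apply/le_GA => x []..|].
have /le_GA RP : R <= P by apply: HR; left.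
have /le_GA RQ : R <= Q by apply: HR; right.
by apply/le_GA => x Rx; split; [apply: RP|apply: RQ].
Qed.

(** [LU(x, y, ...)] is the join of the principal ideal of [x] with
    [LU(y, ...)], because every member of [G(A)] is LU-closed.  Lists are kept
    non-empty since [LU] of the empty set need not belong to [G(A)]. *)
Lemma join_cut_generated S (subS : sublattice S) (XS : principals A `<=` S)
    s (Gs : G_sets A (join_cut s)) : s != [::] -> S (mkG Gs).
Proof.
case: s Gs => // x s; elim: s x => [|y s IH] x Gs _.
  by apply: XS; exists x => //; rewrite /= join_cut1.
have Gt : G_sets A (join_cut (y :: s)) by apply: G_sets_join_cut.
have [_] := subS _ _ (mkG Gs) (XS _ (principal_in x)) (IH y Gt isT).
apply; split=> [P [->|->]|P HP].
- by apply/le_principal; apply: join_cut_mem; rewrite mem_head.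
- apply/le_GA => a /= at_ u us; apply: at_ => z /= zs.
  by apply: us; rewrite /= inE zs orbT.
have /le_principal Px : principal x <= P by apply: HP; left.
have /le_GA Pt : mkG Gt <= P by apply: HP; right.
apply/le_GA => a /= axs; rewrite -(G_sets_LU (GA_setP P)) => u Pu.
apply: axs => z /=; rewrite inE => /predU1P[->|zs]; first exact: Pu.
by apply/Pu/Pt; apply: join_cut_mem.
Qed.

Lemma meet_of_joins_generated S (subS : sublattice S) (XS : principals A `<=` S)
    ss (Gss : G_sets A (meet_of_joins ss)) :
  ss != [::] -> [::] \notin ss -> S (mkG Gss).
Proof.
case: ss Gss => // s ss; elim: ss s => [|t ss IH] s Gss _.
  rewrite inE eq_sym => s0; have Gs := G_sets_join_cut s0.
  have -> : mkG Gss = mkG Gs.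
    apply/val_inj/seteqP; split=> a /= H; first by apply: H; rewrite mem_head.
    by move=> t; rewrite inE => /eqP->.
  exact: join_cut_generated.
rewrite inE negb_or eq_sym => /andP[s0 nt]; have Gs := G_sets_join_cut s0.
have Gt : G_sets A (meet_of_joins (t :: ss)) by apply/G_setsP; exists (t :: ss).
have [Sinf _] := subS _ _ (mkG Gss) (join_cut_generated subS XS Gs s0)
                      (IH t Gt isT nt).
apply: Sinf.
have -> : mkG Gss = meetG (mkG Gs) (mkG Gt).
  apply/val_inj/seteqP; split=> a /=.
    move=> H; split; first by apply: H; rewrite mem_head.
    by move=> r rt; apply: H; rewrite inE rt orbT.
  by move=> [as_ at_] r; rewrite inE => /predU1P[->//|]; apply: at_.
exact: meetG_inf.
Qed.

Lemma principals_generate : generates (principals A).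
Proof.
move=> S XS subS; apply/seteqP; split=> // P _.
have [ss [ss0 nss E]] := (G_setsP (GA_set P)).1 (GA_setP P).
have Gss : G_sets A (meet_of_joins ss) by rewrite -E; apply: GA_setP.
have -> : P = mkG Gss by apply/val_inj.
exact: meet_of_joins_generated.
Qed.

Section Kleene.
Variable prime : A -> A.
Hypothesis hA : kleene_poset prime.

Let distrA : distributive_poset A. Proof. by case: hA. Qed.
Let primeA : antitone_involution prime. Proof. by case: hA. Qed.

Definition perpG P : GA A := mkG (G_sets_perp primeA distrA (GA_setP P)).

Lemma perpG_antitone_involution : antitone_involution perpG.
Proof.
split=> [P Q /le_GA PQ|P]; first by apply/le_GA/perpS.
by apply/val_inj/perpK => //; apply: GA_setP.
Qed.

Definition joinG P Q : GA A := perpG (meetG (perpG P) (perpG Q)).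

Lemma joinG_sup P Q : supremums [set P; Q] (joinG P Q).
Proof.
have [anti invo] := perpG_antitone_involution.
have [lb glb] := meetG_inf (perpG P) (perpG Q).
split=> [R [->|->]|R HR].
- by rewrite -[P in P <= _]invo; apply/anti/lb; left.
- by rewrite -[Q in Q <= _]invo; apply/anti/lb; right.
rewrite -(invo R); apply/anti/glb => _ [->|->]; apply: anti; apply: HR.
  by left.
by right.
Qed.

Lemma joinGl P Q : P <= joinG P Q.
Proof. by apply: (joinG_sup P Q).1; left. Qed.

Lemma joinGr P Q : Q <= joinG P Q.
Proof. by apply: (joinG_sup P Q).1; right. Qed.

Lemma joinG_le P Q R : P <= R -> Q <= R -> joinG P Q <= R.
Proof. by move=> PR QR; apply: (joinG_sup P Q).2 => _ [->|->]. Qed.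

Lemma meetG_distributive : left_distributive meetG joinG.
Proof.
move=> P Q R; apply/le_anti/andP; split; last first.
  apply: joinG_le; apply/le_GA => x [Hx Rx]; split=> //.
    exact: (le_GA _ _).1 (joinGl P Q) _ Hx.
  exact: (le_GA _ _).1 (joinGr P Q) _ Hx.
apply/le_GA => w [PQw Rw]; apply: contrapT => nw.
have [u Hu nwu] := G_sets_separate (GA_setP _) nw.
have [w1 [u1 [w1w uu1 nwu1 decP]]] := nle_cut_G distrA (GA_setP P) nwu.
have [w2 [u2 [w2w1 u1u2 nwu2 decQ]]] := nle_cut_G distrA (GA_setP Q) nwu1.
have w2w := le_trans w2w1 w1w; have uu2 := le_trans uu1 u1u2.
have Rw2 := G_sets_down (GA_setP R) w2w Rw.
case: decP => [Pw1|Pu1].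
  apply: nwu2; apply: le_trans uu2; apply: Hu.
  apply: (le_GA _ _).1 (joinGl (meetG P R) (meetG Q R)) _ _.
  by split=> //; apply: G_sets_down (GA_setP P) w2w1 Pw1.
case: decQ => [Qw2|Qu2].
  apply: nwu2; apply: le_trans uu2; apply: Hu.
  by apply: (le_GA _ _).1 (joinGr (meetG P R) (meetG Q R)) _ _.
apply: nwu2; apply: le_trans w2w _.
have : joinG P Q <= principal u2.
  apply: joinG_le; apply/le_principalr => // x Px.
  exact: le_trans (Pu1 x Px) u1u2.
by move/le_principalr; apply.
Qed.

(** An element of [P] and of its perp is below its own prime, and an upper bound
    of [Q] and of its perp is above its own prime, so the inequality reduces to
    the one assumed in [A]. *)
Lemma meetG_perp_le_joinG_perp P Q : meetG P (perpG P) <= joinG Q (perpG Q).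
Proof.
have [_ _ kl] := hA; have [_ invo] := primeA.
apply/le_GA => w [Pw /(perpE primeA) /(_ w Pw) ww'].
apply: contrapT => nw; have [u Hu] := G_sets_separate (GA_setP _) nw; apply.
have u'u : prime u <= u.
  apply: (Hu); apply: (le_GA _ _).1 (joinGr Q (perpG Q)) _ _.
  apply/(perpE primeA) => x Qx; rewrite invo; apply: Hu.
  exact: (le_GA _ _).1 (joinGl Q (perpG Q)) _ Qx.
by apply: (kl w u); move=> _ [->|->].
Qed.

Lemma GA_kleene_lattice : kleene_lattice perpG.
Proof.
exists meetG, joinG; split.
- by move=> P Q; split; [apply: meetG_inf|apply: joinG_sup].
- exact: meetG_distributive.
- exact: perpG_antitone_involution.
- exact: meetG_perp_le_joinG_perp.
Qed.

Lemma perpG_principal a : perpG (principal a) = principal (prime a).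
Proof. exact/val_inj/perp_principal. Qed.

Lemma principals_involution_closed : involution_closed perpG (principals A).
Proof.
move=> P [a _ Pa]; exists (prime a) => //.
by rewrite -(perp_principal primeA) Pa.
Qed.

Lemma le_principal2 : {mono principal : x y / x <= y}.
Proof.
move=> x y; apply/idP/idP => [/le_principal|xy]; first exact.
by apply/le_principal => _ ->.
Qed.

Lemma principals_isomorphic : isomorphic_onto prime perpG (principals A).
Proof.
exists principal; split; last 2 first.
- exact: le_principal2.
- by move=> a; rewrite perpG_principal.
split=> [a _|a b _ _ E|P [a _ Pa]]; first exact: principal_in.
  by apply/le_anti; rewrite -!le_principal2 E lexx.
by exists a => //; apply/val_inj.
Qed.

End Kleene.
End Lattice.

Theorem proposition5p8 (d : Order.disp_t) (A : porderType d) (prime : A -> A)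
    (hA : kleene_poset prime) :
  principal_sets A `<=` G_sets A /\
  exists bot : GA A -> GA A,
    (forall C : GA A, GA_set (bot C) = perp prime (GA_set C)) /\
    [/\ kleene_lattice bot,
        involution_closed bot (principals A),
        doubly_dense (principals A),
        generates (principals A) &
        isomorphic_onto prime bot (principals A)].
Proof.
split=> [_ [a _ <-]|]; first exact: G_sets_principal.
exists (perpG hA); split=> //; split.
- exact: GA_kleene_lattice.
- exact: principals_involution_closed.
- exact: principals_doubly_dense.
- exact: principals_generate.
- exact: principals_isomorphic.
Qed.
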